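(* Let $B>1$ and $d>1$ be integers. Let $p_1,\dots,p_r$ be distinct primes, each belonging to $M_d(B)$, let $h_1,\dots,h_r$ be positive integers, and let $N=p_1^{h_1}\cdots p_r^{h_r}$. For each $i$ let $e_i=\operatorname{ord}(B,p_i)=dk_i$, let $c_i\ge0$ be the largest integer with $d^{c_i}\mid k_i$, write $k_i=d^{c_i}w_i$, and let $u_i=\prod_{q\mid d} q^{v_q(w_i)}$ be the part of $w_i$ composed of primes dividing $d$. Let $U=\operatorname{lcm}(d^{c_1}u_1,\dots,d^{c_r}u_r)$. Then $N\in M_d(B)$ if and only if $$U/(d^{c_i}u_i)\not\equiv 0\pmod d\quad\text{for every } i=1,\dots,r.$$ (In particular, this condition depends only on the primes $p_1,\dots,p_r$ and not on the exponents $h_1,\dots,h_r$.) If $d$ is a prime $q$, then $N\in M_q(B)$ if and only if $v_q(e_1)=v_q(e_2)=\dots=v_q(e_r)$.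
   Context: $\operatorname{ord}(B,n)$ is the least positive integer $e$ with $B^e\equiv1\pmod n$; $v_q(w)$ denotes the exponent of the prime $q$ in $w$. For integers $B>1$, $N>1$ with $\gcd(N,B)=1$, let $e=\operatorname{ord}(B,N)$; for a divisor $d$ of $e$ put $k=e/d$. For $x$ with $1\le x<N$, $\gcd(x,N)=1$, let $x/N=0.a_1a_2\ldots$ be its base-$B$ expansion (purely periodic with period $a_1\ldots a_e$), and let $S_d(x)=\sum_{j=1}^d\sum_{i=1}^k a_{(j-1)k+i}B^{k-i}$ be the sum of the integers represented in base $B$ by the $d$ consecutive blocks of length $k$ of the period. We say $N\in M_d(B)$ if $d\mid e$ and $S_d(x)\equiv0\pmod{B^k-1}$ for every such $x$. *)

(* Defs.v *)
From mathcomp Require Import all_boot cyclic.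

Set Implicit Arguments.
Unset Strict Implicit.
Unset Printing Implicit Defensive.

Lemma ord_mod_exists (B n : nat) :
  coprime B n -> exists e, (0 < e) && (B ^ e == 1 %[mod n]).
Proof.
case: n => [|n] coBn; last first.
  by exists (totient n.+1); rewrite totient_gt0 /=; apply/eqP/Euler_exp_totient.
by exists 1; move: coBn; rewrite /coprime gcdn0 => /eqP->.
Qed.

(* The least positive [e] with [B ^ e = 1 %[mod n]]; the value [0] is junk,
   taken exactly when no such [e] exists. *)
Definition ord_mod (B n : nat) : nat :=
  if @idP (coprime B n) is ReflectT coBn then ex_minn (ord_mod_exists coBn)
  else 0.

Lemma ord_modP (B n : nat) : coprime B n ->
  [/\ 0 < ord_mod B n, B ^ ord_mod B n = 1 %[mod n]
    & forall f, 0 < f -> B ^ f = 1 %[mod n] -> ord_mod B n <= f].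
Proof.
rewrite /ord_mod => coBn; case: {-}_ / idP => // coBn'.
case: ex_minnP => e /andP[e_gt0 /eqP Be] min_e; split=> // f f_gt0 Bf.
by apply: min_e; rewrite f_gt0; apply/eqP.
Qed.

(* For [0 <= x < N] and [i >= 1], the [i]-th digit after the point of the
   base-[B] expansion of [x / N], i.e. floor (x B^i / N) reduced modulo [B];
   see [digit_lt] and [digit_expansion]. *)
Definition digit (B N x i : nat) : nat := (x * B ^ i %/ N) %% B.

Lemma digit_lt (B N x i : nat) : 0 < B -> digit B N x i < B.
Proof. exact: ltn_pmod. Qed.

(* The truncation to [m] digits is within [B ^ - m] below [x / N]. *)
Lemma digit_expansion (B N x m : nat) : 0 < B -> x < N ->
  x * B ^ m =
    (\sum_(1 <= i < m.+1) digit B N x i * B ^ (m - i)) * N + (x * B ^ m) %% N.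
Proof.
move=> B_gt0 lt_xN; rewrite {1}(divn_eq (x * B ^ m) N); congr (_ * _ + _).
elim: m => [|m IHm]; first by rewrite big_geq // muln1 divn_small.
rewrite (divn_eq (_ %/ N) B) big_nat_recr //= subnn muln1; congr (_ + _).
rewrite -divnMA expnSr mulnA divnMr // IHm big_distrl /=.
rewrite !big_nat; apply: eq_bigr => i /andP[_ le_im].
by rewrite subSn // expnSr mulnA.
Qed.

(* Sum of the integers written in base [B] by the first [d] consecutive blocks
   of [k] digits of [x / N]. *)
Definition block_sum (B N x d k : nat) : nat :=
  \sum_(1 <= j < d.+1) \sum_(1 <= i < k.+1)
    digit B N x ((j - 1) * k + i) * B ^ (k - i).

(* [midy d B N] is membership of [N] in M_d(B). *)
Definition midy (d B N : nat) : Prop :=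
  let e := ord_mod B N in
  let k := e %/ d in
  [/\ 1 < B, 1 < N, coprime N B, d %| e
    & forall x, 1 <= x < N -> coprime x N ->
        block_sum B N x d k = 0 %[mod B ^ k - 1]].

(* Main.v *)
Require Import Defs.
From mathcomp Require Import all_boot.

Set Implicit Arguments.
Unset Strict Implicit.
Unset Printing Implicit Defensive.

(** Summing the relations [r_j B^k = A_(j+1) N + r_(j+1)] between the remainders
    [r_j = x B^(jk) %% N] and the blocks [A_j] over one period gives
    [S_d(x) N = (B^k - 1) * \sum_j r_j], so [N] is in [M_d(B)] iff [d] divides
    [e = ord(B, N)] and [N] divides [1 + B^k + ... + B^((d-1)k)], [k = e / d].
    For [N = \prod_i p_i ^ h_i] this geometric sum times [B^k - 1] is divisible
    by [N]; if [e_i] does not divide [k], all of [p_i ^ h_i] must divide the sum,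
    while if [e_i] divides [k] the sum is [d] modulo [p_i], and [p_i] does not
    divide [d] because [d] divides [p_i - 1].  Hence the criterion is that no
    [d e_i] divides [e].  Finally [e] and [lcm e_i] differ by a factor coprime
    to [d], so only the parts of the [k_i] supported on the primes of [d]
    matter. *)

(** * Orders, geometric sums and divisibility *)

Lemma eqn_mod1_predn (n a : nat) : 0 < a -> (a == 1 %[mod n]) = (n %| a.-1).
Proof. by move=> a_gt0; rewrite eqn_mod_dvd // subn1. Qed.

Lemma expn_mod1 (n a m : nat) : a = 1 %[mod n] -> a ^ m = 1 %[mod n].
Proof. by move=> a1; rewrite -modnXm a1 modnXm exp1n. Qed.

Lemma dvdn_ord_mod (B n f : nat) : 0 < B -> coprime B n ->
  (ord_mod B n %| f) = (n %| (B ^ f).-1).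
Proof.
move=> B_gt0 /ord_modP[]; move: (ord_mod B n) => e e_gt0 Be1 min_e.
rewrite -eqn_mod1_predn ?expn_gt0 ?B_gt0 //.
have ->: (B ^ f == 1 %[mod n]) = (B ^ (f %% e) == 1 %[mod n]).
  rewrite {1}(divn_eq f e) expnD [f %/ e * e]mulnC expnM.
  by rewrite -modnMml (expn_mod1 _ Be1) modnMml mul1n.
apply/idP/eqP => [/eqP-> // | Bfe1]; rewrite /dvdn -leqn0 leqNgt.
apply/negP => fe_gt0; have := min_e _ fe_gt0 Bfe1.
by rewrite leqNgt ltn_pmod.
Qed.

Lemma geometric_sum_mod1 (n a d : nat) : a = 1 %[mod n] ->
  \sum_(j < d) a ^ j = d %[mod n].
Proof.
move=> a1; rewrite -modn_summ; under eq_bigr do rewrite (expn_mod1 _ a1).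
by rewrite modn_summ sum1_card card_ord.
Qed.

(** Each further [n]-th power multiplies [b - 1] by a geometric sum of [n] terms congruent to 1,
    hence by a multiple of [n]. This lifts an order modulo [p] to one modulo a power of [p]. *)
Lemma dvdn_predn_expn (n a h : nat) :
  n %| a.-1 -> n ^ h.+1 %| (a ^ (n ^ h)).-1.
Proof.
case: a => [|a] na.
  (* Both [0] and [0 ^ 0 = 1] have predecessor [0]. *)
  suff ->: (0 ^ (n ^ h)).-1 = 0 by exact: dvdn0.
  by case: (n ^ h) => // m; rewrite exp0n.
elim: h => [|h IHh]; first by rewrite expn0 !expn1.
rewrite expnSr [in X in _ %| X]expnSr expnM predn_exp dvdn_mul //.
set b := a.+1 ^ (n ^ h); have b1: b = 1 %[mod n].
  apply/eqP; rewrite eqn_mod1_predn ?expn_gt0 //.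
  by apply: dvdn_trans IHh; rewrite expnS dvdn_mulr.
by rewrite /dvdn (geometric_sum_mod1 _ b1) modnn.
Qed.

Lemma prod_dvdn (I : finType) (F : I -> nat) (m : nat) :
  (forall i j, i != j -> coprime (F i) (F j)) -> (forall i, F i %| m) ->
  \prod_i F i %| m.
Proof.
move=> coF Fm; elim: (index_enum I) (index_enum_uniq I) => [|i s IHs] /=.
  by rewrite big_nil dvd1n.
case/andP=> i_s /IHs Fs; rewrite big_cons Gauss_dvd ?Fm //.
rewrite big_seq; elim/big_ind: _ => [|x y|j j_s]; first exact: coprimen1.
  by rewrite coprimeMr => -> ->.
by apply: coF; apply: contraNneq i_s => ->.
Qed.

(** * Remainders, digit blocks and block sums *)

Lemma digit_shift (B N x m i : nat) : 0 < N -> 0 < i ->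
  digit B N x (m + i) = digit B N (x * B ^ m %% N) i.
Proof.
move=> N_gt0 i_gt0; rewrite /digit expnD mulnA {1}(divn_eq (x * B ^ m) N).
rewrite mulnDl mulnAC divnMDl // -(prednK i_gt0) expnSr mulnA.
by rewrite modnMDl.
Qed.

Lemma block_sum_mul (B N x d k : nat) : 0 < B -> 0 < N ->
  B ^ (d * k) = 1 %[mod N] ->
  block_sum B N x d k * N = (B ^ k).-1 * \sum_(j < d) (x * B ^ (j * k) %% N).
Proof.
move=> B_gt0 N_gt0 Bdk; pose r j := x * B ^ (j * k) %% N.
have Bk_gt0: 0 < B ^ k by rewrite expn_gt0 B_gt0.
pose A j := \sum_(1 <= i < k.+1) digit B N (r j) i * B ^ (k - i).
have rS j: r j * B ^ k = A j * N + r j.+1.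
  rewrite (digit_expansion k B_gt0 (ltn_pmod _ N_gt0)); congr (_ + _).
  by rewrite modnMml -mulnA -expnD addnC -mulSn.
have sumA: block_sum B N x d k = \sum_(j < d) A j.
  rewrite /block_sum big_add1 big_mkord; apply: eq_bigr => j _.
  rewrite /A !big_nat; apply: eq_bigr => i /andP[i_gt0 _].
  by rewrite subn1 digit_shift.
(* The remainders are periodic, [r d = r 0]; adding [r 0] turns both sides into sums over [d + 1]
   consecutive remainders. *)
have shift: \sum_(j < d) r j.+1 = \sum_(j < d) r j.
  apply/eqP; rewrite -(eqn_add2r (r 0)) addnC -(big_ord_recl _ (fun j : 'I_d.+1 => r j)).
  rewrite big_ord_recr /= eqn_add2l /r -modnMmr Bdk modnMmr mul0n expn0.
  by rewrite muln1.
have: (\sum_(j < d) r j) * B ^ k = block_sum B N x d k * N + \sum_(j < d) r j.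
  rewrite sumA !big_distrl /= -shift -big_split /=.
  by apply: eq_bigr => j _; rewrite rS.
rewrite -{1}(prednK Bk_gt0) mulnS addnC => /eqP; rewrite eqn_add2r => /eqP <-.
by rewrite mulnC.
Qed.

Lemma midyE (B d N : nat) : 1 < B -> 0 < d -> 1 < N -> coprime N B ->
  midy d B N <-> d %| ord_mod B N /\
    N %| \sum_(j < d) B ^ (j * (ord_mod B N %/ d)).
Proof.
move=> B_gt1 d_gt0 N_gt1 coNB; rewrite /midy; set e := ord_mod B N; set k := e %/ d.
have B_gt0 := ltnW B_gt1; have N_gt0 := ltnW N_gt1.
have := @ord_modP B N; rewrite coprime_sym -/e => /(_ coNB)[e_gt0 Be1 _].
(* Multiply both sides of the divisibility by [N], then cancel the positive factor [B ^ k - 1]; what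
   remains is the sum of the remainders modulo [N]. *)
have main x : d %| e -> (block_sum B N x d k == 0 %[mod B ^ k - 1]) =
    (N %| x * \sum_(j < d) B ^ (j * k)).
  move=> de; have dk: d * k = e by rewrite mulnC divnK.
  have k_gt0: 0 < k by move: e_gt0; rewrite -dk muln_gt0 => /andP[].
  have Bk: 0 < (B ^ k).-1 by rewrite -subn1 subn_gt0 -(expn0 B) ltn_exp2l.
  rewrite mod0n subn1 -/(_ %| _) -(dvdn_pmul2r N_gt0) block_sum_mul ?dk //.
  by rewrite dvdn_pmul2l // /dvdn modn_summ big_distrr.
split=> [[_ _ _ de all_x] | [de dvN]].
  (* The single numerator [1] already yields the divisibility of the geometric sum. *)
  have:= all_x 1; rewrite coprime1n N_gt1 => /(_ isT isT)/eqP.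
  by rewrite main // mul1n.
by split=> // x _ _; apply/eqP; rewrite main // dvdn_mull.
Qed.

(** * The criterion on the orders modulo the primes *)

Lemma midy_prod (B d : nat) (I : finType) (p h : I -> nat) :
  1 < B -> 1 < d -> 0 < #|I| -> (forall i, prime (p i)) -> injective p ->
  (forall i, 0 < h i) -> (forall i, coprime (p i) B) ->
  (forall i, d %| ord_mod B (p i)) ->
  midy d B (\prod_i p i ^ h i) <->
  forall i, ~~ (d * ord_mod B (p i) %| \big[lcmn/1]_j ord_mod B (p j)).
Proof.
move=> B_gt1 d_gt1 /card_gt0P[i0 _] p_pr p_inj h_gt0 coB de.
set N := \prod_i _; set L := \big[lcmn/1]_j _.
have B_gt0 := ltnW B_gt1; have d_gt0 := ltnW d_gt1.
have coBp i: coprime B (p i) by rewrite coprime_sym.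
have dvphN i: p i ^ h i %| N by rewrite /N (bigD1 i) //= dvdn_mulr.
have dvpph i: p i %| p i ^ h i by rewrite Euclid_dvdX // dvdnn h_gt0.
have dvpN i: p i %| N := dvdn_trans (dvpph i) (dvphN i).
have N_gt0: 0 < N by rewrite prodn_gt0 // => i; rewrite expn_gt0 prime_gt0.
have N_gt1: 1 < N.
  exact: leq_trans (prime_gt1 (p_pr i0)) (dvdn_leq N_gt0 (dvpN i0)).
have coNB: coprime N B.
  rewrite /N; elim/big_ind: _ => [|x y|i _]; first exact: coprime1n.
    by rewrite coprimeMl => -> ->.
  exact: coprimeXl.
have coBN: coprime B N by rewrite coprime_sym.
have p_dvd i: ~~ (p i %| d).
  have ep: ord_mod B (p i) %| (p i).-1.
    rewrite dvdn_ord_mod // -eqn_mod1_predn ?expn_gt0 ?B_gt0 // -totient_prime //.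
    by rewrite cyclic.Euler_exp_totient.
  have p_gt1 := prime_gt1 (p_pr i).
  apply/negP=> /(dvdn_leq d_gt0); rewrite leqNgt => /negP[].
  rewrite -[ltnRHS]prednK ?prime_gt0 // ltnS dvdn_leq //; first by case: (p i) p_gt1 => [|[]].
  exact: dvdn_trans (de i) ep.
have co_dN: coprime d N.
  rewrite /N; elim/big_ind: _ => [|x y|i _]; first exact: coprimen1.
    by rewrite coprimeMr => -> ->.
  by rewrite coprimeXr // coprime_sym prime_coprime.
have co_p i j: i != j -> coprime (p i ^ h i) (p j ^ h j).
  move=> ne_ij; rewrite coprimeXl ?coprimeXr // prime_coprime // dvdn_prime2 //.
  by apply: contra_neqN ne_ij => /eqP/p_inj.
set E := ord_mod B N.
have eL i : ord_mod B (p i) %| L by apply: (biglcmn_sup i).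
have eE i: ord_mod B (p i) %| E.
  rewrite dvdn_ord_mod //; apply: dvdn_trans (dvpN i) _.
  by rewrite -dvdn_ord_mod.
have LE: L %| E by apply/dvdn_biglcmP.
have dE: d %| E := dvdn_trans (de i0) (eE i0).
(* [B ^ L] is 1 modulo [p i], so its [p i ^ h i]-th power is 1 modulo [p i ^ h i], and [N] is a
   multiple of that exponent. *)
have ELN: E %| L * N.
  rewrite dvdn_ord_mod //; apply: prod_dvdn => [i j|i]; first exact: co_p.
  apply: (@dvdn_trans (p i ^ (h i).+1)); first by rewrite dvdn_exp2l.
  have := @dvdn_predn_expn (p i) (B ^ L) (h i); rewrite -dvdn_ord_mod // => /(_ (eL i)).
  move/dvdn_trans; apply; case/dvdnP: (dvphN i) => q ->.
  by rewrite mulnCA mulnC !expnM [X in _ %| X]predn_exp dvdn_mulr.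
(* Passing from [L] to [L * N] changes nothing here, because [N] is coprime to [d]. *)
have dvE i: (d * ord_mod B (p i) %| E) = (d * ord_mod B (p i) %| L).
  apply/idP/idP => [/dvdn_trans/(_ ELN)|/dvdn_trans]; last exact.
  have [l ->] := dvdnP (eL i); have [e_gt0 _ _] := ord_modP (coBp i).
  by rewrite mulnAC !dvdn_pmul2r // Gauss_dvdl.
apply: iff_trans (midyE B_gt1 d_gt0 N_gt1 coNB) _.
rewrite -/E; set K := E %/ d; have dK: K * d = E by rewrite divnK.
have eK i: (d * ord_mod B (p i) %| E) = (p i %| (B ^ K).-1).
  by rewrite -dK mulnC dvdn_pmul2r // dvdn_ord_mod.
under eq_bigr do rewrite mulnC expnM.
split=> [[_ dvN] i | not_dvL].
  rewrite -dvE eK -eqn_mod1_predn ?expn_gt0 ?B_gt0 //.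
  apply: contra (p_dvd i) => /eqP/(geometric_sum_mod1 d) sum_d.
  by rewrite /dvdn -sum_d; apply: dvdn_trans (dvpN i) dvN.
split=> //; apply: prod_dvdn => [i j ne_ij|i]; first exact: co_p.
have := dvphN i; have: N %| (B ^ E).-1 by rewrite -dvdn_ord_mod.
rewrite -dK expnM predn_exp => dvN /dvdn_trans/(_ dvN).
by rewrite Gauss_dvdr // coprimeXl // prime_coprime // -eK dvE.
Qed.

(** * Parts supported on the primes of [d], and lcms *)

Lemma partn_primes (d w : nat) : 0 < d ->
  \prod_(q <- primes d) q ^ logn q w = w`_\pi(d).
Proof.
(* The range defining the part is widened to [maxn w d] so that it contains every prime of [d];
   primes not dividing [w] get exponent 0. *)
move=> d_gt0; rewrite (widen_partn _ (leq_maxl w d)) -[RHS]big_filter.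
apply/perm_big/uniq_perm; rewrite ?primes_uniq ?filter_uniq ?iota_uniq // => q.
rewrite mem_filter mem_index_iota ltnS leq_max; case: (boolP (q \in \pi(d))) => //=.
by rewrite mem_primes => /and3P[_ _ /(dvdn_leq d_gt0)->]; rewrite orbT.
Qed.

(** With [n = l * m] both sides reduce to [d] dividing [l] or its [\pi(d)]-part, which agree because
    [d] is its own [\pi(d)]-part. *)
Lemma dvdn_partl (d m n : nat) : 0 < d -> 0 < n -> m %| n ->
  (d * m %| n) = (d * m`_\pi(d) %| n`_\pi(d)).
Proof.
move=> d_gt0 n_gt0 /dvdnP[l def_n]; move: n_gt0; rewrite def_n muln_gt0.
case/andP=> l_gt0 m_gt0; rewrite partnM // !dvdn_pmul2r ?part_gt0 //.
apply/idP/idP => [|/dvdn_trans]; last by apply; apply: dvdn_part.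
by move/(partn_dvd \pi(d) l_gt0); rewrite part_pnat_id ?pnat_pi.
Qed.

Lemma biglcmn_gt0 (I : finType) (F : I -> nat) :
  (forall i, 0 < F i) -> 0 < \big[lcmn/1]_i F i.
Proof.
by move=> F_gt0; elim/big_ind: _ => // m n m_gt0 n_gt0; rewrite lcmn_gt0 m_gt0.
Qed.

Lemma biglcmn_mull (I : finType) (F : I -> nat) (d : nat) : 0 < #|I| ->
  \big[lcmn/1]_i (d * F i) = d * \big[lcmn/1]_i F i.
Proof.
case/card_gt0P=> i0 _; apply/eqP; rewrite eqn_dvd; apply/andP; split.
  by apply/dvdn_biglcmP=> i _; rewrite dvdn_mul // (biglcmn_sup i).
have [->|d_gt0] := posnP d; first by apply: (biglcmn_sup i0); rewrite ?mul0n.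
have /dvdnP[m def_m]: d %| \big[lcmn/1]_i (d * F i).
  by apply: (biglcmn_sup i0); rewrite ?dvdn_mulr.
rewrite def_m mulnC dvdn_pmul2r //; apply/dvdn_biglcmP=> i _.
rewrite -(dvdn_pmul2r d_gt0) -def_m mulnC.
exact: (biglcmn_sup i).
Qed.

(** The valuation of the lcm is the maximum of the valuations, and [q * F i] divides the lcm exactly
    when [F i] falls short of that maximum. *)
Lemma all_eq_logn_biglcmn (I : finType) (F : I -> nat) (q : nat) :
  prime q -> (forall i, 0 < F i) ->
  (forall i, ~~ (q * F i %| \big[lcmn/1]_j F j)) <->
  (forall i j, logn q (F i) = logn q (F j)).
Proof.
move=> q_pr F_gt0; set L := \big[lcmn/1]_j F j.
have FL i: F i %| L by apply: (biglcmn_sup i).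
have L_gt0: 0 < L by apply: biglcmn_gt0.
have dvL i: (q * F i %| L) = (logn q (F i) < logn q L).
  rewrite -dvdn_divRL // -subn_gt0 -logn_div // logn_gt0 mem_primes q_pr.
  by rewrite divn_gt0 // dvdn_leq.
have le_L i: logn q (F i) <= logn q L by rewrite dvdn_leq_log.
split=> [ndvL i j | eq_log i].
  have eqL l: logn q (F l) = logn q L.
    by apply/eqP; rewrite eqn_leq le_L leqNgt -dvL ndvL.
  by rewrite !eqL.
rewrite dvL -leqNgt -(dvdn_Pexp2l _ _ (prime_gt1 q_pr)) -!p_part.
rewrite partn_biglcm //; apply/dvdn_biglcmP=> j _.
by rewrite !p_part (eq_log j i).
Qed.

Theorem theorem4 (B d r : nat) (hB : 1 < B) (hd : 1 < d) (hr : 0 < r)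
  (p h : 'I_r -> nat)
  (p_prime : forall i, prime (p i))
  (p_distinct : injective p)
  (p_midy : forall i, midy d B (p i))
  (h_pos : forall i, 0 < h i)
  (N : nat) (hN : N = \prod_(i < r) p i ^ h i)
  (e k c w u : 'I_r -> nat)
  (he : forall i, e i = ord_mod B (p i))
  (hk : forall i, e i = d * k i)
  (hc : forall i, d ^ c i %| k i)
  (hc_max : forall i m, d ^ m %| k i -> m <= c i)
  (hw : forall i, k i = d ^ c i * w i)
  (hu : forall i, u i = \prod_(q <- primes d) q ^ logn q (w i))
  (U : nat) (hU : U = \big[lcmn/1]_(i < r) (d ^ c i * u i)) :
  [/\ midy d B N <-> (forall i, U %/ (d ^ c i * u i) <> 0 %[mod d]),
      forall h' : 'I_r -> nat, (forall i, 0 < h' i) ->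
        (midy d B (\prod_(i < r) p i ^ h' i) <-> midy d B N)
    & prime d ->
        (midy d B N <-> forall i j, logn d (e i) = logn d (e j))].
Proof.
have d_gt0 := ltnW hd.
have coB i: coprime (p i) B by have [] := p_midy i.
have de i: d %| ord_mod B (p i) by have [] := p_midy i.
have e_gt0 i: 0 < e i.
  by rewrite he; have [] := @ord_modP B (p i); rewrite 1?coprime_sym.
have k_gt0 i: 0 < k i by have:= e_gt0 i; rewrite hk muln_gt0 => /andP[].
(* The right-hand side does not mention [g], which gives the independence of the exponents at
   once. *)
have midy_lcm g: (forall i, 0 < g i) ->
    midy d B (\prod_i p i ^ g i) <->
    forall i, ~~ (d * e i %| \big[lcmn/1]_j e j).
  move=> g_gt0; apply: iff_trans (midy_prod _ _ _ _ _ _ _ _) _; rewrite ?card_ord //.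
  rewrite -(eq_bigr _ (fun j _ => he j)).
  by split=> dvL i; have:= dvL i; rewrite he.
split=> [|g g_gt0|d_pr]; last 2 first.
- by rewrite hN; apply: iff_trans (midy_lcm g g_gt0) (iff_sym (midy_lcm h h_pos)).
- rewrite hN; apply: iff_trans (midy_lcm h h_pos) _.
  exact: all_eq_logn_biglcmn.
have kpart i: (k i)`_\pi(d) = d ^ c i * u i.
  have:= k_gt0 i; rewrite hu partn_primes // hw muln_gt0 => /andP[dc_gt0 w_gt0].
  by rewrite partnM // part_pnat_id // pnatX pnat_pi.
have defU: U = (\big[lcmn/1]_i k i)`_\pi(d).
  by rewrite hU partn_biglcm //; apply: eq_bigr => i _.
have k_lcm i: k i %| \big[lcmn/1]_j k j by apply: (biglcmn_sup i).
have lcm_gt0: 0 < \big[lcmn/1]_j k j by apply: biglcmn_gt0.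
(* Cancel the common factor [d] of all [e j = d * k j], then pass to [\pi(d)]-parts, which turn
   [k i] into [d ^ c i * u i] and the lcm into [U]. *)
have critE i: (d * e i %| \big[lcmn/1]_j e j) = (d %| U %/ (d ^ c i * u i)).
  rewrite (eq_bigr _ (fun j _ => hk j)) biglcmn_mull ?card_ord // hk.
  rewrite dvdn_pmul2l // dvdn_partl // defU -kpart dvdn_divRL //.
  exact: partn_dvd.
rewrite hN; apply: iff_trans (midy_lcm h h_pos) _; split=> crit i; have:= crit i; rewrite critE mod0n.
  by move/eqP.
by move/eqP.
Qed.
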